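(* Let $n,r,t$ be positive integers with $t>1$ and $n\ge r+1$. Then $$\operatorname{ex}_{S_t}(n,S_{r+1})=\begin{cases} n\binom{r}{t} & \text{if } nr \text{ is even},\\[2pt] (n-1)\binom{r}{t}+\binom{r-1}{t} & \text{otherwise.}\end{cases}$$
   Context: Graphs are finite and simple. $S_r$ denotes the star $K_{1,r}$. For graphs $T$ and $F$, $n_T(G)$ is the number of copies of $T$ in $G$, and $\operatorname{ex}_T(n,F)=\max\{n_T(G): G \text{ is an } F\text{-free graph on } n \text{ vertices}\}$, where $F$-free means containing no (not necessarily induced) subgraph isomorphic to $F$. For $t>1$, $n_{S_t}(G)=\sum_{v\in V(G)}\binom{d(v)}{t}$. *)

(* Defs.v *)
From HB Require Import structures.
From mathcomp Require Import all_boot.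

Set Implicit Arguments.
Unset Strict Implicit.
Unset Printing Implicit Defensive.

Record graph (V : finType) := Graph {
  edges : {set {set V}};
  edges_card2 : [forall e in edges, #|e| == 2]
}.

HB.instance Definition _ (V : finType) := [isSub for @edges V].
HB.instance Definition _ (V : finType) := [Finite of graph V by <:].

(* A pair (U, D) stands for the graph with vertex set U and edge set D. *)
Definition is_subgraph (V : finType) (H : {set V} * {set {set V}})
    (G : graph V) : bool :=
  (H.2 \subset edges G) && [forall e in H.2, e \subset H.1].

Definition is_isomorphic (W V : finType) (T : graph W)
    (H : {set V} * {set {set V}}) : bool :=
  [exists f : {ffun W -> V},
    [&& injectiveb f, f @: [set: W] == H.1
      & [set f @: e | e : {set W} in edges T] == H.2]].

(* Copies are counted as subgraphs, not as embeddings. *)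
Definition ncopies (W V : finType) (T : graph W) (G : graph V) : nat :=
  #|[set H | is_subgraph H G && is_isomorphic T H]|.

Definition is_free (W V : finType) (F : graph W) (G : graph V) : bool :=
  ~~ [exists H, is_subgraph H G && is_isomorphic F H].

(* If no graph on n vertices is F-free, the value is 0 by convention; this
   cannot happen when F has an edge, the empty graph being F-free. *)
Definition ex_copies (W W' : finType) (T : graph W) (n : nat) (F : graph W') : nat :=
  \max_(G : graph 'I_n | is_free F G) ncopies T G.

Lemma star_edges_card2 (r : nat) :
  [forall e in [set [set None; Some i] | i : 'I_r], #|e| == 2].
Proof. by apply/forall_inP => e /imsetP[i _ ->]; rewrite cards2. Qed.

(* The centre is None and the leaves are the Some i. *)
Definition star (r : nat) : graph (option 'I_r) := Graph (star_edges_card2 r).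

(* Main.v *)
Require Import Defs.
From mathcomp Require Import all_boot ssralg zmodp.
From mathcomp Require Import zify.

(** A copy of [S_t] with [t > 1] is a centre together with a [t]-set of its
    neighbours, and the centre can be read off the copy as the common point of
    its edges; so a graph contains [\sum_v 'C(d(v), t)] copies
    ([ncopies_star]). Likewise a graph contains a copy of [S_(r+1)] exactly when
    some vertex has [r+1] neighbours ([star_freeP]). The question becomes how
    large [\sum_v 'C(d(v), t)] can be when all degrees are at most [r].

    Upper bound: each summand is at most ['C(r, t)]. If [n] and [r] are both
    odd, the degrees cannot all equal [r], since their sum would be odd
    ([handshake]); so some vertex contributes at most ['C(r-1, t)].

    Lower bound: on the cyclic group [Z/n], join two vertices when their
    difference lies between [1] and [r./2] up to sign; every degree is then
    [2 * r./2]. When [r] is odd, add the matching that joins [i] to [i + n./2]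
    for [i < n./2]. Its edges are new, because [r./2 < n./2] when [r] is odd and
    [r < n], and it covers every vertex except the last one when [n] is odd. All
    degrees are thus [r], except that the last vertex has degree [r-1] when [n]
    and [r] are both odd ([degree_near_regular]). *)

Set Implicit Arguments.
Unset Strict Implicit.
Unset Printing Implicit Defensive.

(** * Degrees and the handshake lemma *)

Section Degrees.
Variables (V : finType) (G : graph V).
Implicit Types (u v : V) (A : {set V}) (e : {set V}).

Definition neighbours v : {set V} := [set u | [set v; u] \in edges G].

Definition degree v : nat := #|neighbours v|.

Lemma card_edge e : e \in edges G -> #|e| = 2.
Proof. by move=> eG; apply/eqP; apply: (forall_inP (edges_card2 G)). Qed.

Lemma neighbours_irrefl v : v \notin neighbours v.
Proof. by rewrite inE; apply/negP => /card_edge; rewrite cards2 eqxx. Qed.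

Lemma set2_injr v : injective (fun u => [set v; u]).
Proof.
move=> u w eq_uw.
have: w \in [set v; u] by rewrite eq_uw set22.
have: u \in [set v; w] by rewrite -eq_uw set22.
by rewrite !inE => /orP[]/eqP-> // /orP[]/eqP->.
Qed.

(** Turns the degree into a count of edges, the form needed for counting
    incidences in two ways. *)
Lemma degree_incident v : degree v = #|[set e in edges G | v \in e]|.
Proof.
rewrite /degree -(card_imset _ (@set2_injr v)); apply: eq_card => e.
rewrite !inE; apply/imsetP/andP => [[u + ->]|[eG ve]].
  by rewrite !inE eqxx => ->.
have /cards2P[x [y [_ def_e]]] : #|e| == 2 by rewrite card_edge.
move: ve eG; rewrite def_e !inE => /orP[]/eqP-> eG.
  by exists y; rewrite ?inE.
by exists x; rewrite ?inE setUC.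
Qed.

Lemma handshake : \sum_v degree v = (#|edges G|).*2.
Proof.
under eq_bigr => v _ do rewrite degree_incident -sum1dep_card big_mkcondr.
rewrite exchange_big /= -muln2 -sum_nat_const; apply: eq_bigr => e eG.
by rewrite -big_mkcond sum1_card card_edge.
Qed.

End Degrees.

(** * Stars as a centre and a set of leaves *)

Section Stars.
Variable V : finType.
Implicit Types (G : graph V) (v w : V) (A B : {set V}).

Definition star_at v A : {set V} * {set {set V}} :=
  (v |: A, [set [set v; a] | a in A]).

(** An embedding of the star amounts to the image of its centre and an
    enumeration of the images of its leaves; forgetting the enumeration gives
    the copy, and any enumeration of a [t]-set gives the embedding back. *)
Lemma star_copyP t (H : {set V} * {set {set V}}) :
  reflect (exists v A, [/\ v \notin A, #|A| = t & H = star_at v A])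
          (is_isomorphic (star t) H).
Proof.
apply: (iffP existsP) => [[f /and3P[/injectiveP injf /eqP fV /eqP fE]]|].
  exists (f None), [set f (Some i) | i : 'I_t]; split.
  - by apply/imsetP=> -[i _ /injf].
  - by rewrite card_imset ?card_ord // => i j /injf[].
  rewrite [H]surjective_pairing -fV -fE; congr (_, _); apply/setP=> x.
    rewrite in_setU1; apply/imsetP/orP => [[[i|] _ ->]|].
    - by right; apply: imset_f.
    - by left.
    by case=> [/eqP->|/imsetP[i _ ->]]; [exists None | exists (Some i)].
  have fS i : f @: [set None; Some i] = [set f None; f (Some i)].
    by rewrite imsetU1 imset_set1.
  apply/imsetP/imsetP => [[e /imsetP[i _ ->] ->]|[a /imsetP[i _ ->] ->]].
    by exists (f (Some i)); [apply/imsetP; exists i | exact: fS].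
  by exists [set None; Some i]; [apply/imsetP; exists i | rewrite fS].
case=> v [A [vA cA ->]].
pose a (i : 'I_t) := enum_val (cast_ord (esym cA) i).
have aA i : a i \in A by apply: enum_valP.
have a_onto x : x \in A -> exists i, x = a i.
  move=> xA; exists (cast_ord cA (enum_rank_in xA x)).
  by rewrite /a cast_ordK enum_rankK_in.
pose f := [ffun o => if o is Some i then a i else v].
have fS i : f @: [set None; Some i] = [set v; a i].
  by rewrite imsetU1 imset_set1 !ffunE.
exists f; apply/and3P; split=> /=.
- apply/injectiveP=> -[i|] [j|]; rewrite !ffunE //.
  + by move/enum_val_inj/cast_ord_inj->.
  + by move=> av; rewrite -av aA in vA.
  + by move=> va; rewrite va aA in vA.
- apply/eqP/setP=> x; rewrite in_setU1; apply/imsetP/orP.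
    by case=> -[i|] _ ->; rewrite ffunE; [right | left].
  case=> [/eqP->|/a_onto[i ->]]; last first.
    by exists (Some i); [rewrite inE | rewrite ffunE].
  by exists None; [rewrite inE | rewrite ffunE].
apply/eqP/setP=> x; apply/imsetP/imsetP => [[e /imsetP[i _ ->] ->]|].
  by exists (a i).
case=> _ /a_onto[i ->] ->.
by exists [set None; Some i]; [apply/imsetP; exists i | rewrite fS].
Qed.

Lemma subgraph_star_at G v A :
  is_subgraph (star_at v A) G = (A \subset neighbours G v).
Proof.
apply/andP/subsetP => [[/subsetP EG _] a aA|AN].
  by rewrite inE EG //; apply/imsetP; exists a.
split; first by apply/subsetP=> _ /imsetP[a /AN + ->]; rewrite inE.
by apply/forall_inP=> _ /imsetP[a aA ->]; rewrite setUS // sub1set.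
Qed.

(** With at least two leaves, the centre is the only point common to all edges
    of the star. A single edge could be centred at either end, whence the bound
    on [#|A|]. *)
Lemma star_at_inj v w A B : v \notin A -> w \notin B -> 1 < #|A| ->
  star_at v A = star_at w B -> (v, A) = (w, B).
Proof.
move=> vA wB /card_gt1P[x [y [xA yA xy]]] [eqV eqE].
have w_in a : a \in A -> w \in [set v; a].
  move=> aA; have: [set v; a] \in [set [set w; b] | b in B].
    by rewrite -eqE; apply/imsetP; exists a.
  by case/imsetP=> b _ ->; rewrite !inE eqxx.
have eq_vw : v = w.
  apply/eqP; apply: contraNT xy => vw.
  have := w_in x xA; have := w_in y yA.
  by rewrite !inE !(eq_sym w) (negPf vw) /= => /eqP-> /eqP->.
by rewrite -eq_vw in wB eqV *; rewrite -(setU1K vA) eqV setU1K.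
Qed.

Lemma ncopies_star G t : 1 < t ->
  ncopies (star t) G = \sum_v 'C(degree G v, t).
Proof.
move=> t_gt1.
pose P := [set p : V * {set V} |
  (p.2 \subset neighbours G p.1) && (#|p.2| == t)].
have P_out p : p \in P -> p.1 \notin p.2.
  rewrite inE => /andP[/subsetP pN _].
  by apply: contra (neighbours_irrefl G p.1) => /pN.
have injP : {in P &, injective (fun p => star_at p.1 p.2)}.
  move=> [v A] [w B] vP wP /star_at_inj; apply.
  - exact: P_out vP.
  - exact: P_out wP.
  by move: vP; rewrite inE => /andP[_ /eqP->].
transitivity #|P|.
  rewrite /ncopies -(card_in_imset injP); apply: eq_card => H; rewrite inE.
  apply/andP/imsetP => [[HG /star_copyP[v [A [vA cA HE]]]]|[[v A] vP ->]].
    exists (v, A) => //.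
    by move: HG; rewrite HE subgraph_star_at inE /= cA eqxx andbT.
  have vA := P_out _ vP; move: vP; rewrite inE => /andP[AN /eqP cA].
  by rewrite subgraph_star_at; split=> //; apply/star_copyP; exists v, A.
rewrite -sum1dep_card -(pair_big_dep xpredT
  (fun v A => (A \subset neighbours G v) && (#|A| == t)) (fun _ _ => 1)) /=.
by apply: eq_bigr => v _; rewrite sum1dep_card cards_draws.
Qed.

Lemma star_freeP G t :
  reflect (forall v, degree G v <= t) (is_free (star t.+1) G).
Proof.
apply: (iffP idP) => [free v|deg].
  rewrite leqNgt; apply: contra free => lt_t.
  have : 0 < #|[set A : {set V} | A \subset neighbours G v & #|A| == t.+1]|.
    by rewrite cards_draws bin_gt0.
  case/card_gt0P=> A; rewrite inE => /andP[AN /eqP cA].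
  apply/existsP; exists (star_at v A); rewrite subgraph_star_at AN.
  apply/star_copyP; exists v, A; split=> //.
  by apply: contra (neighbours_irrefl G v); apply: (subsetP AN).
apply/existsP=> -[H /andP[HG /star_copyP[v [A [_ cA HE]]]]].
move: HG; rewrite HE subgraph_star_at => /subset_leq_card.
by rewrite cA leqNgt ltnS deg.
Qed.

End Stars.

(** * Graphs given by a relation *)

Section RelGraph.
Variables (V : finType) (e : rel V).
Hypotheses (e_irr : irreflexive e) (e_sym : symmetric e).

Definition rel_edges := [set [set p.1; p.2] | p : V * V & e p.1 p.2].

Lemma rel_edges_card2 : [forall a in rel_edges, #|a| == 2].
Proof.
apply/forall_inP=> _ /imsetP[[x y] /= xy ->].
rewrite cards2 eqSS eqb1; apply: contraTneq xy => ->.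
by rewrite inE /= e_irr.
Qed.

Definition rel_graph : graph V := Graph rel_edges_card2.

Lemma neighbours_rel_graph v : neighbours rel_graph v = [set u | e v u].
Proof.
apply/setP=> u; rewrite !inE; apply/imsetP/idP => [[[x y]]|vu]; last first.
  by exists (v, u); rewrite ?inE.
rewrite inE /= => xy eqS.
have: v \in [set x; y] by rewrite -eqS set21.
case/set2P=> def_v; rewrite def_v in eqS *.
  by rewrite (set2_injr eqS).
by rewrite (setUC [set x]) in eqS; rewrite (set2_injr eqS) e_sym.
Qed.

End RelGraph.

(** * A graph with all degrees equal to r, up to one *)

Section NearRegular.
(* The vertex set has [n.+1] elements, so that it carries a group structure. *)
Variables n r : nat.
Let m := r./2.
Let h := (n.+1)./2.

Definition gap : {set 'I_n.+1} := [set x : 'I_n.+1 | 0 < x <= m].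

Definition near (x y : 'I_n.+1) : bool :=
  ((y - x)%R \in gap) || ((x - y)%R \in gap).

Definition matched (x y : nat) : bool :=
  ((x < h) && (y == x + h)) || ((y < h) && (x == y + h)).

Definition near_regular_rel (x y : 'I_n.+1) : bool :=
  near x y || (odd r && matched x y).

Lemma near_regular_rel_irr : irreflexive near_regular_rel.
Proof.
move=> x; rewrite /near_regular_rel /near GRing.subrr inE /=.
rewrite /matched; lia.
Qed.

Lemma near_regular_rel_sym : symmetric near_regular_rel.
Proof.
move=> x y; rewrite /near_regular_rel /near /matched.
by congr (_ || (_ && _)); apply: orbC.
Qed.

Definition near_regular : graph 'I_n.+1 :=
  rel_graph near_regular_rel_irr.

Lemma val_subZp (x y : 'I_n.+1) :
  (x - y)%R = (if y <= x then x - y else x + n.+1 - y) :> nat.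
Proof.
have := ltn_ord x; have := ltn_ord y => ? ? /=.
rewrite modnDmr; case: leqP => ?; last by rewrite modn_small; lia.
by rewrite (_ : x + _ = x - y + n.+1) ?modnDr ?modn_small; lia.
Qed.

Hypothesis r_le_n : r <= n.

Lemma card_gap : #|gap| = m.
Proof.
pose f (i : 'I_m) : 'I_n.+1 := inord i.+1.
have fE i : f i = i.+1 :> nat by rewrite inordK //; have := ltn_ord i; lia.
rewrite -[RHS]card_ord -(card_imset _ (f := f)); last first.
  by move=> i j /(congr1 val) /=; rewrite !fE => -[] /val_inj.
apply: eq_card => x; rewrite inE; apply/idP/imsetP => [xm|[i _ ->]].
  have lt_x : x.-1 < m by lia.
  by exists (Ordinal lt_x) => //; apply: val_inj; rewrite /= fE /=; lia.
by rewrite fE ltn_ord.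
Qed.

(** The neighbourhood of [x] is the disjoint union of the translates by [x] of
    [gap] and of its opposite, and of the partner of [x] in the matching. The
    first two do not meet because [r./2.*2 < n.+1]; for odd [r] the partner is
    at cyclic distance at least [n.+1./2] on the one side and [n.+1 - n.+1./2] on
    the other, and both exceed [r./2]. *)
Lemma degree_near_regular (x : 'I_n.+1) :
  degree near_regular x = (r./2).*2 + (odd r && (x < (n.+1)./2.*2)).
Proof.
rewrite -/m -/h /degree neighbours_rel_graph; last exact: near_regular_rel_sym.
pose A := [set y : 'I_n.+1 | (y - x)%R \in gap].
pose B := [set y : 'I_n.+1 | (x - y)%R \in gap].
pose C := [set y : 'I_n.+1 | odd r && matched x y].
have cA : #|A| = m.
  rewrite on_card_preimset ?card_gap //; apply: onW_bij.
  by exists (fun y => y + x)%R => y; rewrite ?GRing.subrK ?GRing.addrK.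
have cB : #|B| = m.
  rewrite on_card_preimset ?card_gap //; apply: onW_bij.
  by exists (fun y => x - y)%R => y; rewrite GRing.subKr.
have cC : #|C| = (odd r && (x < h.*2)).
  have mC y : (y \in C) = odd r && matched x y by rewrite inE.
  have lt_xn := ltn_ord x; rewrite /matched in mC.
  case: (boolP (odd r && (x < h.*2))) => [/andP[r_odd lt_xh]|no].
    pose y := if x < h then x + h else x - h.
    have lt_y : y < n.+1 by rewrite /y /h in lt_xh *; case: ifP; lia.
    rewrite (_ : C = [set Ordinal lt_y]) ?cards1 //; apply/setP=> z.
    rewrite mC r_odd inE -val_eqE /= /y; case: ifP; lia.
  by apply: eq_card0 => y; rewrite mC; apply: contraNF no; lia.
have le_m : m.*2 <= n by rewrite /m; lia.
have disjAB : [disjoint A & B].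
  apply/pred0P=> y /=; rewrite !inE !val_subZp.
  have := ltn_ord x; have := ltn_ord y; case: (leqP x y); case: (leqP y x); lia.
have disjABC : [disjoint A :|: B & C].
  apply/pred0P=> y /=; rewrite !inE !val_subZp /matched.
  have : odd r -> m < h by rewrite /m /h; lia.
  have : n <= h.*2 <= n.+1 by rewrite /h; lia.
  have := ltn_ord x; have := ltn_ord y; case: (leqP x y); case: (leqP y x); lia.
rewrite (_ : [set u | _] = A :|: B :|: C); last first.
  by apply/setP=> u; rewrite 3!inE /near_regular_rel /near !inE.
have [_] := leq_card_setU (A :|: B) C; rewrite disjABC => /eqP->.
have [_] := leq_card_setU A B; rewrite disjAB => /eqP->.
by rewrite cA cB cC addnn.
Qed.

End NearRegular.

Theorem proposition1p11 (n r t : nat) (n_gt0 : 0 < n) (r_gt0 : 0 < r)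
    (t_gt1 : 1 < t) (le_r1_n : r + 1 <= n) :
  ex_copies (star t) n (star (r + 1)) =
    if ~~ odd (n * r) then n * 'C(r, t)
    else (n - 1) * 'C(r, t) + 'C(r - 1, t).
Proof.
rewrite addn1 in le_r1_n *; rewrite /ex_copies.
case: n n_gt0 le_r1_n => // n _; rewrite ltnS => le_rn.
apply/eqP; rewrite eqn_leq; apply/andP; split.
  apply/bigmax_leqP => G /star_freeP deg_le; rewrite ncopies_star //.
  have leC v : 'C(degree G v, t) <= 'C(r, t) by apply: leq_bin2l.
  case: ifPn => [_|/negPn odd_nr].
    rewrite -[n.+1 in leqRHS]card_ord -sum_nat_const; exact: leq_sum.
  have [v deg_v] : exists v, degree G v < r.
    apply/existsP; apply: contraTT odd_nr => /existsPn deg_ge.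
    have <- : \sum_v degree G v = n.+1 * r.
      rewrite -[n.+1 in RHS]card_ord -sum_nat_const; apply: eq_bigr => v _.
      by apply/eqP; rewrite eqn_leq deg_le leqNgt deg_ge.
    by rewrite handshake odd_double.
  rewrite (bigD1 v) //= addnC leq_add //; last by apply: leq_bin2l; lia.
  apply: (@leq_trans (\sum_(u | u != v) 'C(r, t))); first exact: leq_sum.
  by rewrite sum_nat_const cardC1 card_ord subn1.
pose G := near_regular n r.
have degG := degree_near_regular le_rn; rewrite -/G in degG.
apply: leq_trans (leq_bigmax_cond _ (_ : is_free _ G)); last first.
  by apply/star_freeP => x; rewrite degG; lia.
rewrite ncopies_star //; case: ifPn => [even_nr|/negPn odd_nr].
  rewrite -[n.+1 in leqLHS]card_ord -sum_nat_const; apply: leq_sum => x _.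
  rewrite degG leq_bin2l //; have := ltn_ord x.
  by move: even_nr; rewrite oddM; lia.
(* For [n.+1] odd, [ord_max] is the vertex that the matching misses. *)
rewrite (bigD1 ord_max) //= addnC leq_add //.
  by rewrite degG leq_bin2l /=; lia.
have -> : n.+1 - 1 = #|predC1 (ord_max : 'I_n.+1)|.
  by rewrite cardC1 card_ord subn1.
rewrite -sum_nat_const; apply: leq_sum => x x_max.
rewrite degG leq_bin2l //; have := ltn_ord x.
have : x != n :> nat by [].
by move: odd_nr; rewrite oddM; lia.
Qed.
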